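(* Let $G$ be a locally compact group that is not discrete. Given any $\mu\in\mathcal M(G)$ and any $x\in G\setminus\{e\}$, there exists a net $\langle S_\alpha\rangle$ in $\mathscr C^+$ such that $\mu_{S_\alpha}\to\mu$ in the $w^*$-topology, but $S_\alpha\cap xS_\alpha=\varnothing$ for all $\alpha$.
   Context: $|E|$ denotes the left Haar measure of $E\subset G$, and $e$ is the identity of $G$. $\mathcal L_\infty(G)$ is the usual space with respect to Haar measure, identified with the dual of $\mathcal L_1(G)$. The set of means is $\mathcal M(G)=\{\mu\in\mathcal L_\infty^*(G): \|\mu\|=1,\ \mu\ge 0\}$, with the $w^*$-topology. Each $f\in\mathcal L_1(G)$ is regarded as an element of $\mathcal L_\infty^*(G)$ via $\phi\mapsto\int_G f\phi$. $\mathscr C^+$ is the set of compact subsets of $G$ with positive measure. For $A\in\mathscr C^+$, $\mu_A=\chi_A/|A|\in\mathcal L_1(G)$, regarded as a mean. *)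

(* Defs.v *)
From HB Require Import structures.
From mathcomp Require Import all_boot all_order all_algebra.
From mathcomp Require Import complex.
From mathcomp Require Import all_classical all_reals all_analysis.
From mathcomp Require Import measurable_realfun.

Set Implicit Arguments.
Unset Strict Implicit.
Unset Printing Implicit Defensive.

Import Order.TTheory GRing.Theory Num.Theory.
Import numFieldNormedType.Exports.
Local Open Scope classical_set_scope.
Local Open Scope ring_scope.
Local Open Scope complex_scope.

(* [Pointed] is only there because [measurableType] asks for it: the point is
   an arbitrary element of the group. *)
#[short(type="preTopologicalGroupType")]
HB.structure Definition PreTopologicalGroup :=
  {G of Group G & PointedTopological G}.

HB.mixin Record PreTopologicalGroup_isTopologicalGroup G
    & PreTopologicalGroup G := {
  mulg_continuous : continuous (fun p : G * G => (p.1 * p.2)%g) ;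
  invg_continuous : continuous (fun x : G => x^-1%g)
}.

#[short(type="topologicalGroupType")]
HB.structure Definition TopologicalGroup :=
  {G of PreTopologicalGroup G & PreTopologicalGroup_isTopologicalGroup G}.

Notation borel G := (g_sigma_algebraType (@open G)).

Definition left_translate (G : groupType) (x : G) (A : set G) : set G :=
  [set (x * y)%g | y in A].

Section Haar.
Context {R : realType} {G : topologicalGroupType}.
Implicit Type m : {measure set (borel G) -> \bar R}.

(* Left Haar measures are Radon measures on the Borel sets: outer regular on
   Borel sets, inner regular on open sets.  No sigma-finiteness is assumed. *)
Definition left_haar m : Prop :=
  [/\ m [set: G] != 0%E,
      forall K : set G, compact K -> (m K < +oo)%E,
      forall A : set G, measurable (A : set (borel G)) ->
        m A = ereal_inf [set m U | U in [set U : set G | open U /\ A `<=` U]],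
      forall U : set G, open U ->
        m U = ereal_sup [set m K | K in [set K : set G | compact K /\ K `<=` U]]
    & forall (x : G) (A : set G), measurable (A : set (borel G)) ->
        m (left_translate x A) = m A].

Definition compact_pos m : set (set G) :=
  [set A | compact A /\ (0 < m A)%E].

(* When G is not sigma-compact, L_oo is the dual of L_1 only if null sets are
   replaced by locally null sets, and measurable functions by locally
   measurable ones. *)
Definition locally_null m (N : set G) : Prop :=
  forall F : set G, measurable (F : set (borel G)) -> (m F < +oo)%E ->
    m.-negligible (N `&` F).

Definition locally_ae m (P : G -> Prop) : Prop :=
  locally_null m [set x | ~ P x].

Definition locally_measurable m (f : G -> R) : Prop :=
  forall F : set G, measurable (F : set (borel G)) -> (m F < +oo)%E ->
    measurable_fun (F : set (borel G)) (f : borel G -> R).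

End Haar.

Section Linfty.
Context {R : realType} {G : topologicalGroupType}.
Variable m : {measure set (borel G) -> \bar R}.

Definition ess_bound (phi : G -> R[i]) (M : R) : Prop :=
  locally_ae m (fun x => `|phi x| <= M%:C).

(* [R[i]^o] is the complex field with its topology, as a module over itself. *)
Definition in_Linfty : {pred G -> R[i]^o} := mem [set phi : G -> R[i]^o |
  [/\ locally_measurable m (fun x => complex.Re (phi x)),
      locally_measurable m (fun x => complex.Im (phi x))
    & exists M : R, ess_bound phi M]].

Lemma locally_null_sub (A B : set G) :
  A `<=` B -> locally_null m B -> locally_null m A.
Proof.
move=> AB NB F mF Foo; apply: negligibleS (NB F mF Foo).
by apply: setSI.
Qed.

Lemma locally_null_setU (A B : set G) :
  locally_null m A -> locally_null m B -> locally_null m (A `|` B).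
Proof.
move=> NA NB F mF Foo; rewrite setIUl.
by apply: negligibleU; [exact: NA|exact: NB].
Qed.

Let ReMD (a b c : R[i]) : complex.Re (a * b + c) =
  complex.Re a * complex.Re b - complex.Im a * complex.Im b + complex.Re c.
Proof. by case: a b c => [? ?] [? ?] []. Qed.

Let ImMD (a b c : R[i]) : complex.Im (a * b + c) =
  complex.Re a * complex.Im b + complex.Im a * complex.Re b + complex.Im c.
Proof. by case: a b c => [? ?] [? ?] []. Qed.

Lemma in_Linfty_submod_closed : submod_closed in_Linfty.
Proof.
split=> [|a f g]; rewrite !inE /=.
  split; try by move=> F _ _; exact: measurable_cst.
  exists 0 => F mF Foo; rewrite (_ : _ `&` F = set0); last first.
    apply/seteqP; split=> x // -[h _]; case: h => /=.
    by rewrite normr0 lexx.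
  exact: negligible_set0.
move=> [mfr mfi [M fM]] [mgr mgi [N gN]]; split.
- move=> F mF Foo.
  rewrite (_ : (fun x => _) = (fun x : borel G =>
      complex.Re a * complex.Re (f x) - complex.Im a * complex.Im (f x)
      + complex.Re (g x))); last first.
    by apply/funext => x; exact: ReMD.
  apply: measurable_funD; last exact: mgr.
  by apply: measurable_funB; apply: measurable_funM => //;
    [exact: mfr|exact: mfi].
- move=> F mF Foo.
  rewrite (_ : (fun x => _) = (fun x : borel G =>
      complex.Re a * complex.Im (f x) + complex.Im a * complex.Re (f x)
      + complex.Im (g x))); last first.
    by apply/funext => x; exact: ImMD.
  apply: measurable_funD; last exact: mgi.
  by apply: measurable_funD; apply: measurable_funM => //;
    [exact: mfi|exact: mfr].
- exists (complex.Re `|a| * M + N).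
  apply: locally_null_sub (locally_null_setU fM gN) => x h.
  apply/not_andP => -[fx gx]; apply: h => /=.
  apply: (le_trans (ler_normD _ _)).
  rewrite rmorphD rmorphM /= lerD// normrM.
  have -> : (complex.Re `|a|)%:C = `|a| by rewrite normc_def.
  by rewrite ler_wpM2l.
Qed.

HB.instance Definition _ :=
  GRing.isSubmodClosed.Build R[i] (G -> R[i]^o) in_Linfty
    in_Linfty_submod_closed.

(* Functions are not identified when they agree locally almost everywhere: a
   functional of finite norm for the seminorm [Linfty_norm] vanishes on locally
   null functions, so it is the same thing as a functional on the quotient. *)
Record Linfty := MkLinfty {
  Linfty_fun :> G -> R[i]^o ;
  _ : Linfty_fun \in in_Linfty }.

HB.instance Definition _ := [isSub for Linfty_fun].
HB.instance Definition _ := [Choice of Linfty by <:].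
HB.instance Definition _ := [SubChoice_isSubLmodule of Linfty by <:].

Definition Linfty_norm (phi : Linfty) : R :=
  inf [set M : R | 0 <= M /\ ess_bound phi M].

Definition functional_norm (mu : Linfty -> R[i]^o) : \bar R :=
  ereal_sup [set (complex.Re `|mu phi|)%:E
            | phi in [set phi | Linfty_norm phi <= 1]].

Definition mean (mu : {linear Linfty -> R[i]^o}) : Prop :=
  functional_norm mu = 1%E /\
  (forall phi : Linfty, locally_ae m (fun x => 0 <= phi x) -> 0 <= mu phi).

Definition cintegral (f : G -> R[i]) : R[i] :=
  Rintegral m setT (fun x => complex.Re (f x)) +i*
  Rintegral m setT (fun x => complex.Im (f x)).

Definition L1_functional (f : G -> R[i]) (phi : Linfty) : R[i]^o :=
  cintegral (fun x => f x * phi x).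

Definition normalized_indicator (A : set G) : G -> R[i] :=
  fun x => (\1_A x / fine (m A))%:C.

Definition mean_of_set (A : set G) : Linfty -> R[i]^o :=
  L1_functional (normalized_indicator A).

End Linfty.

Arguments mean_of_set {R G} m A phi.

Definition directed_preorder (I : Type) (le : I -> I -> Prop) : Prop :=
  [/\ inhabited I,
      forall i, le i i,
      forall i j k, le i j -> le j k -> le i k
    & forall i j, exists k, le i k /\ le j k].

Definition net_filter (I : Type) (le : I -> I -> Prop) : set_system I :=
  [set P | exists i0, forall i, le i0 i -> P i].

(* The w*-topology on functionals is the topology of pointwise convergence. *)
Definition weak_star_cvg {R : realType} {G : topologicalGroupType}
    (m : {measure set (borel G) -> \bar R}) (I : Type) (le : I -> I -> Prop)
    (u : I -> Linfty m -> R[i]^o) (mu : Linfty m -> R[i]^o) : Prop :=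
  {ptws, u @ net_filter le --> mu}.

(* Main.v *)
Require Import Defs.
From mathcomp Require Import all_boot all_order all_algebra.
From mathcomp Require Import complex.
From mathcomp Require Import all_classical all_reals all_analysis.
From mathcomp Require Import measurable_realfun ring lra.
Import Order.TTheory GRing.Theory Num.Theory.
Import numFieldNormedType.Exports.
Local Open Scope classical_set_scope.
Local Open Scope ring_scope.
Local Open Scope complex_scope.

Set Implicit Arguments.
Unset Strict Implicit.
Unset Printing Implicit Defensive.

(** Finitely many functions phi_i in L_oo take values within e of a constant
    c_ij on each cell E_j of one finite partition of the group.  A mean mu sees
    them, up to e, only through the weights lam_j = mu (chi_(E_j)), which are
    nonnegative and add up to 1: mu phi_i is within e of the sum of the
    c_ij lam_j.  The mean of a compact set S sees them through the proportions
    of the volume of S lying in the various cells.  So it is enough to find,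
    for each d > 0, a compact set of positive measure that is disjoint from its
    translate by x and meets the cells in proportions within d of the lam_j
    ([proportional_pieces]).

    A cell of positive weight is not locally null, hence contains a compact set
    of positive measure.  Since the group is not discrete, points are null and
    every point p has open neighbourhoods of small measure; since p <> xp, they
    can be taken disjoint from their translates by x.  Shrinking the compact
    sets one at a time, so that each avoids the translates by x and by x^-1 of
    the small pieces already chosen, gives one piece L_j in each relevant cell
    with L_i disjoint from x L_j for all i and j ([compact_pieces_moved]).
    These pieces can be cut down almost at will: a compact set is covered by
    finitely many open sets of measure less than d, and removing them one by
    one passes within d of every prescribed volume ([compact_sized_piece]).
    Cutting L_j down to volume close to a lam_j, for a common a > 0, yields the
    required proportions.

    The partition of the group comes from slicing the range of the functions
    ([Linfty_partition]), and mu (1) = 1 from applying the same approximation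
    to a function of norm 1 at which mu nearly attains its norm ([mean_one]).
    The net is indexed by the pairs of a finite list of functions and an
    integer k, the error allowed being 1 / (k + 1). *)

(** * Sets of finite measure *)

Lemma disjointF (T : Type) (A B : set T) (t : T) :
  A `&` B = set0 -> A t -> B t -> False.
Proof. by rewrite -subset0 => AB0 At Bt; exact: (AB0 t). Qed.

Section FiniteVolume.
Context {R : realType} {G : topologicalGroupType}.
Variable m : {measure set (borel G) -> \bar R}.

Definition finite_volume (A : set G) : Prop :=
  measurable (A : set (borel G)) /\ (m A < +oo)%E.

Definition vol (A : set G) : R := fine (m A).

Lemma volE A : finite_volume A -> m A = (vol A)%:E.
Proof.
move=> [_ Afin]; rewrite /vol fineK//.
by rewrite ge0_fin_numE.
Qed.

Lemma vol_ge0 A : 0 <= vol A.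
Proof. exact: fine_ge0. Qed.

Lemma finite_volumeS (A B : set G) : measurable (A : set (borel G)) ->
  finite_volume B -> A `<=` B -> finite_volume A.
Proof.
move=> mA [mB Bfin] AB; split=> //; apply: le_lt_trans Bfin.
by apply: le_measure => //; exact: mem_set.
Qed.

Lemma finite_volumeU (A B : set G) :
  finite_volume A -> finite_volume B -> finite_volume (A `|` B).
Proof.
move=> fA fB; split; first exact: (measurableU _ _ fA.1 fB.1).
apply: (@le_lt_trans _ _ (m A + m B)%E); first exact: measureU2 fA.1 fB.1.
by rewrite (volE fA) (volE fB) -EFinD ltry.
Qed.

Lemma finite_volumeD (A B : set G) : finite_volume A ->
  measurable (B : set (borel G)) -> finite_volume (A `\` B).
Proof.
move=> fA mB; apply: (finite_volumeS (measurableD fA.1 mB) fA).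
exact: subDsetl.
Qed.

Lemma finite_volumeI (A B : set G) : finite_volume A ->
  measurable (B : set (borel G)) -> finite_volume (A `&` B).
Proof.
move=> fA mB; apply: (finite_volumeS (measurableI _ _ fA.1 mB) fA).
exact: subIsetl.
Qed.

Lemma vol0 : vol set0 = 0.
Proof. by rewrite /vol measure0. Qed.

Lemma le_vol (A B : set G) : measurable (A : set (borel G)) ->
  finite_volume B -> A `<=` B -> vol A <= vol B.
Proof.
move=> mA fB AB; have fA := finite_volumeS mA fB AB.
rewrite -lee_fin -!volE//.
by apply: le_measure => //; apply: mem_set => //; exact: fB.1.
Qed.

Lemma volDI (A B : set G) : finite_volume A ->
  measurable (B : set (borel G)) -> vol A = vol (A `\` B) + vol (A `&` B).
Proof.
move=> fA mB; apply: EFin_inj; rewrite EFinD -!volE//.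
- exact: (measureDI m fA.1 mB).
- exact: finite_volumeI.
- exact: finite_volumeD.
Qed.

Lemma volU_le (A B : set G) : finite_volume A -> finite_volume B ->
  vol (A `|` B) <= vol A + vol B.
Proof.
move=> fA fB; rewrite -lee_fin EFinD -!volE//; last exact: finite_volumeU.
exact: (measureU2 m fA.1 fB.1).
Qed.

Lemma volU_disjoint (A B : set G) : finite_volume A -> finite_volume B ->
  A `&` B = set0 -> vol (A `|` B) = vol A + vol B.
Proof.
move=> fA fB AB0; rewrite (volDI (finite_volumeU fA fB) fB.1).
rewrite setDUl setDv setU0 setIUl AB0 set0U setIid; congr (vol _ + _).
by apply/setDidPl; rewrite -AB0.
Qed.

Lemma finite_volume_bigsetU (I : Type) (s : seq I) (F : I -> set G) :
  (forall i, finite_volume (F i)) ->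
  finite_volume (\big[setU/set0]_(i <- s) F i).
Proof.
move=> fF; elim/big_ind : _ => //; last exact: finite_volumeU.
by split; [exact: measurable0|rewrite measure0].
Qed.

Lemma vol_bigsetU (I : choiceType) (s : seq I) (F : I -> set G) : uniq s ->
  (forall i, finite_volume (F i)) ->
  (forall i j, i != j -> F i `&` F j = set0) ->
  vol (\big[setU/set0]_(i <- s) F i) = \sum_(i <- s) vol (F i).
Proof.
move=> + fF F0; elim: s => [_|i s IH /= /andP[iNs us]].
  by rewrite !big_nil vol0.
rewrite !big_cons volU_disjoint ?IH//; first exact: finite_volume_bigsetU.
rewrite -subset0 => t [Fit]; rewrite -bigcup_seq => -[j /= js Fjt].
have ij : i != j by apply: contraNneq iNs => ->.
exact: (disjointF (F0 _ _ ij) Fit Fjt).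
Qed.

End FiniteVolume.

(** * Small compact sets for Haar measure *)

Section HaarPieces.
Context {R : realType} {G : topologicalGroupType}.
Variable m : {measure set (borel G) -> \bar R}.
Hypothesis G_hausdorff : hausdorff_space G.
Hypothesis m_haar : left_haar m.

Local Notation vol := (vol m).
Local Notation finite_volume := (finite_volume m).

Lemma open_borel (U : set G) : open U -> measurable (U : set (borel G)).
Proof. by move=> oU; apply: sub_sigma_algebra. Qed.

Lemma compact_borel (K : set G) : compact K -> measurable (K : set (borel G)).
Proof.
move=> cK; rewrite -(setCK K); apply: measurableC; apply: open_borel.
by apply: closed_openC; apply: compact_closed.
Qed.

Lemma compact_finite_volume (K : set G) : compact K -> finite_volume K.
Proof.
by move=> cK; split; [exact: compact_borel|case: m_haar => _ + _ _ _; exact].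
Qed.

Lemma compactD_open (K U : set G) : compact K -> open U -> compact (K `\` U).
Proof.
move=> cK oU; apply: (subclosed_compact _ cK); last exact: subDsetl.
by apply: closedI; [exact: compact_closed|exact: open_closedC].
Qed.

Lemma outer_approx (A : set G) (e : R) : finite_volume A -> 0 < e ->
  exists U, [/\ open U, A `<=` U, finite_volume U & vol U < vol A + e].
Proof.
move=> fA e0; have [_ _ /(_ A fA.1) mAE _ _] := m_haar.
have : (m A < (vol A + e)%:E)%E by rewrite (volE fA) lte_fin ltrDl.
rewrite mAE => /ereal_inf_lt[_ [U [oU AU] <-] Ue].
have fU : finite_volume U.
  split; first exact: open_borel.
  by apply: (lt_trans Ue); rewrite ltry.
by exists U; split=> //; move: Ue; rewrite (volE fU) lte_fin.
Qed.

(** Inner regularity, assumed for open sets, passes to Borel sets A of finite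
    measure: take U open around A, K compact in U and W open around U minus A,
    each up to e / 3; then K minus W is compact and inside A. *)
Lemma inner_approx (A : set G) (e : R) : finite_volume A -> 0 < e ->
  exists K, [/\ compact K, K `<=` A & vol A < vol K + e].
Proof.
move=> fA e0; have e3 : 0 < e / 3 by lra.
have [U [oU AU fU Ue]] := outer_approx fA e3.
have [_ _ _ /(_ U oU) mUE _] := m_haar.
have : ((vol U - e / 3)%:E < m U)%E by rewrite (volE fU) lte_fin; lra.
rewrite mUE => /ereal_sup_gt[_ [K [cK KU] <-]].
have fK := compact_finite_volume cK.
rewrite (volE fK) lte_fin => Ke.
have fUA : finite_volume (U `\` A) by exact: finite_volumeD fU fA.1.
have [W [oW UAW fW We]] := outer_approx fUA e3.
exists (K `\` W); split; first exact: compactD_open.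
  move=> t [Kt Wt]; apply: contrapT => At; apply/Wt/UAW; split=> //.
  exact: KU.
have := volDI fU fA.1; rewrite setIidr//.
have := volDI fK fW.1.
have := @le_vol _ _ m (K `&` W) W (finite_volumeI fK fW.1).1 fW
  (@subIsetr _ _ _).
have := @le_vol _ _ m A U fA.1 fU AU.
lra.
Qed.

Lemma left_translateE (x : G) (A : set G) :
  left_translate x A = (fun y => (x^-1 * y)%g) @^-1` A.
Proof.
apply/seteqP; split=> [_ [y Ay <-]|y Ay] /=; first by rewrite mulKg.
by exists (x^-1 * y)%g => //; rewrite mulVKg.
Qed.

Lemma mulg_continuousr (x : G) : continuous (fun y : G => (x * y)%g).
Proof.
move=> y; apply: (@continuous2_cvg _ _ _ _ _ _ (fun _ => x) id
  (fun a b : G => (a * b)%g)).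
- exact: (@mulg_continuous G (x, y)).
- exact: cvg_cst.
- exact: cvg_id.
Qed.

Lemma left_translate_open (x : G) (A : set G) : open A ->
  open (left_translate x A).
Proof.
move=> oA; rewrite left_translateE.
by apply: open_comp => // y _; exact: mulg_continuousr.
Qed.

Lemma left_translate_compact (x : G) (A : set G) : compact A ->
  compact (left_translate x A).
Proof.
move=> cA; apply: continuous_compact => //.
by apply: continuous_subspaceT; exact: mulg_continuousr.
Qed.

Lemma left_translateV (x : G) (A B : set G) :
  A `&` left_translate x^-1 B = set0 -> B `&` left_translate x A = set0.
Proof.
rewrite -!subset0 => AB0 t [Bt [s As st]]; apply: (AB0 s); split=> //.
by exists t => //; rewrite -st mulKg.
Qed.

Lemma vol_left_translate (x : G) (A : set G) :
  measurable (A : set (borel G)) -> vol (left_translate x A) = vol A.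
Proof. by move=> mA; case: m_haar => _ _ _ _; rewrite /vol => ->. Qed.

Lemma finite_volume_left_translate (x : G) (A : set G) :
  finite_volume A -> measurable (left_translate x A : set (borel G)) ->
  finite_volume (left_translate x A).
Proof.
by move=> [mA fA] mxA; split=> //; case: m_haar => _ _ _ _ ->.
Qed.

Hypothesis G_not_discrete : ~ (forall A : set G, open A).

(** If {1} had positive measure, outer regularity would give an open U around 1
    of measure less than twice that; U contains a second point because {1} is
    not open, and two points already have twice the measure of one. *)
Lemma vol_point0 : vol [set 1%g] = 0.
Proof.
have c1 : compact [set (1%g : G)] by exact: compact_set1.
have f1 := compact_finite_volume c1.
apply/eqP/negPn/negP => m1N0.
have m1 : 0 < vol [set 1%g] by rewrite lt_neqAle eq_sym m1N0 vol_ge0.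
have [U [oU /(_ _ erefl) U1 fU Ue]] := outer_approx f1 m1.
have [[y Uy y1]|U1P] := pselect (exists2 y, U y & y <> 1%g).
  have cy : compact [set y] by exact: compact_set1.
  have fy := compact_finite_volume cy.
  have my : vol [set y] = vol [set 1%g].
    rewrite -(vol_left_translate y f1.1); congr (vol _).
    by rewrite left_translateE; apply/seteqP; split=> z /=;
      [move=> ->; rewrite mulVg
      |move/(congr1 (fun z => y * z)%g); rewrite mulVKg mulg1].
  have y10 : [set y] `&` [set 1%g] = set0.
    by rewrite -subset0 => z [/= -> ].
  have := volU_disjoint fy f1 y10.
  have : vol ([set y] `|` [set 1%g]) <= vol U.
    apply: le_vol => //; first exact: measurableU fy.1 f1.1.
    by move=> z [|] /= ->.
  lra.
(* Otherwise U is the open singleton of 1, and its translates are open. *)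
apply: G_not_discrete => A.
rewrite (_ : A = \bigcup_(a in A) left_translate a U).
  by apply: bigcup_open => a _; exact: left_translate_open.
apply/seteqP; split=> [a Aa|b [a Aa [z Uz <-]]].
  by exists a => //; exists 1%g; rewrite ?mulg1.
have [->|z1] := pselect (z = 1%g); first by rewrite mulg1.
by case: U1P; exists z.
Qed.

Lemma small_nbhs (d : R) (p : G) : 0 < d ->
  exists U, [/\ open U, U p, finite_volume U & vol U < d].
Proof.
move=> d0.
have f1 : finite_volume [set 1%g] by exact/compact_finite_volume/compact_set1.
have [U [oU /(_ _ erefl) U1 fU]] := outer_approx f1 d0.
rewrite vol_point0 add0r => Ud; have oV := left_translate_open p oU.
exists (left_translate p U); split=> //.
- by exists 1%g; rewrite ?mulg1.
- exact: finite_volume_left_translate fU (open_borel oV).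
- by rewrite vol_left_translate//; exact: fU.1.
Qed.

Lemma small_nbhs_moved (x : G) (d : R) (p : G) : x <> 1%g -> 0 < d ->
  exists W, [/\ open W, W p, finite_volume W, vol W < d
    & W `&` left_translate x W = set0].
Proof.
move=> x1 d0; have [U [oU Up fU Ud]] := small_nbhs p d0.
have pxp : p != (x * p)%g.
  by apply/eqP => /(congr1 (fun z => z * p^-1)%g); rewrite mulgV mulgK => /esym.
have := G_hausdorff; rewrite open_hausdorff => /(_ _ _ pxp).
move=> [[A B] /= []]; rewrite !inE => Ap Bxp [oA oB AB0'].
have AB0 : A `&` B = set0 by exact: AB0'.
have oV : open ((fun y => (x * y)%g) @^-1` B).
  by apply: open_comp => // y _; exact: mulg_continuousr.
have oW : open (U `&` (A `&` (fun y => (x * y)%g) @^-1` B)).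
  by apply: openI => //; exact: openI.
have mW := open_borel oW.
exists (U `&` (A `&` (fun y => (x * y)%g) @^-1` B)); split=> //.
- by apply: finite_volumeS fU _ => // ? [].
- by apply: le_lt_trans Ud; apply: le_vol => // ? [].
- rewrite -subset0 => t [[_ [At _]] [y [_ [_ /= Bxy]] xy]].
  have Bt : B t by rewrite -xy.
  exact: (disjointF AB0 At Bt).
Qed.

(** Covers are presented as sequences of sets to allow induction on the number
    of sets. *)
Lemma finite_cover (K : set G) (P : set G -> Prop) : compact K ->
  (forall p, exists U, [/\ open U, U p & P U]) ->
  exists n (W : nat -> set G), (forall i, P (W i)) /\
    K `<=` \big[setU/set0]_(i < n) W i.
Proof.
move=> + /choice[W WP]; rewrite compact_cover => cK.
have [i _|t Kt|D _ KD] := cK G setT W.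
- by have [] := WP i.
- by exists t => //; have [] := WP t.
pose l : seq G := finmap.enum_fset D.
exists (size l), (fun i => W (nth 1%g l i)); split=> [i|t /KD[y /= yD Wyt]].
  by have [] := WP (nth 1%g l i).
rewrite -(bigcup_mkord _ (fun i => W (nth 1%g l i))).
exists (index y l) => /=; first by rewrite index_mem.
by rewrite nth_index.
Qed.

(** * Compact pieces that translation by x moves apart *)

(** Of the finitely many small open sets W with W disjoint from x W that cover
    K, one must meet K in positive measure. *)
Lemma compact_moved_piece (x : G) (K : set G) (d : R) : x <> 1%g -> 0 < d ->
  compact K -> 0 < vol K ->
  exists L, [/\ compact L, L `<=` K, 0 < vol L, vol L <= d
    & L `&` left_translate x L = set0].
Proof.
move=> x1 d0 cK K0; have fK := compact_finite_volume cK.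
have [p|n [W [WP KW]]] := finite_cover cK (P := fun W =>
    [/\ finite_volume W, vol W < d & W `&` left_translate x W = set0]).
  have [W [oW Wp fW Wd W0]] := small_nbhs_moved p x1 d0.
  by exists W; split=> //; split.
have finW i : finite_volume (W i) by have [] := WP i.
have [i i0] : exists i, 0 < vol (K `&` W i).
  apply: contrapT => /forallNP KW0.
  suff : vol K <= 0 by rewrite leNgt K0.
  have -> : K = \big[setU/set0]_(i < n) (K `&` W i).
    rewrite -(bigcup_mkord _ (fun i => K `&` W i)) -setI_bigcupr bigcup_mkord.
    exact/esym/setIidl.
  elim: n {KW} => [|n IH]; first by rewrite big_ord0 vol0.
  rewrite big_ord_recr /=; apply: (le_trans (volU_le _ _)).
  - by apply: finite_volume_bigsetU => i; exact: finite_volumeI fK (finW _).1.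
  - exact: finite_volumeI fK (finW _).1.
  - by have /negP := KW0 n; rewrite -leNgt; lra.
have [fW Wd W0] := WP i.
have fKW := finite_volumeI fK fW.1.
have [L [cL LKW Le]] := inner_approx fKW i0.
exists L; split=> //; first by move=> t /LKW[].
- lra.
- apply/ltW/(le_lt_trans _ Wd); apply: le_vol => //; first exact: compact_borel.
  by move=> t /LKW[].
- rewrite -subset0 => t [/LKW[_ Wt] [s /LKW[_ Ws] st]].
  have xWt : left_translate x (W i) t by exists s.
  exact: (disjointF W0 Wt xWt).
Qed.

(** T is enlarged to an open set of measure less than that of K, so that what
    remains of K is compact. *)
Lemma compact_avoiding (K T : set G) : compact K -> compact T ->
  vol T < vol K ->
  exists L, [/\ compact L, L `<=` K, L `&` T = set0 & 0 < vol L].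
Proof.
move=> cK cT TK; have fT := compact_finite_volume cT.
have fK := compact_finite_volume cK.
have [|U [oU TU fU Ue]] := outer_approx fT (e := vol K - vol T); first lra.
exists (K `\` U); split; first exact: compactD_open.
- exact: subDsetl.
- by rewrite -subset0 => t [[_ Ut] /TU].
- have := volDI fK fU.1.
  have := @le_vol _ _ m (K `&` U) U (finite_volumeI fK fU.1).1 fU
    (@subIsetr _ _ _).
  lra.
Qed.

(** The new piece is taken outside x S and x^-1 S, where S is the union of the
    pieces already chosen.  This is possible once the measure of S is small
    compared with that of the next compact set; hence the bound d on the total
    measure, which makes the induction work. *)
Lemma compact_pieces_moved (x : G) (J : choiceType) (s : seq J)
    (K : J -> set G) (d : R) : x <> 1%g -> 0 < d ->
  (forall j, j \in s -> compact (K j) /\ 0 < vol (K j)) ->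
  exists L : J -> set G,
    [/\ forall j, j \in s -> [/\ compact (L j), L j `<=` K j & 0 < vol (L j)],
        forall i j, i \in s -> j \in s -> L i `&` left_translate x (L j) = set0
      & vol (\big[setU/set0]_(j <- s) L j) <= d].
Proof.
move=> x1; elim: s d => [|k s IH] d d0 KP.
  by exists (fun=> set0); split=> //; rewrite big_nil vol0 ltW.
have [cKk Kk0] := KP k (mem_head _ _).
(* With S of measure at most d', both translates together measure at most
   2/3 of K k, and d' + d / 2 <= d. *)
pose d' := Num.min (d / 2) (vol (K k) / 3).
have d'0 : 0 < d' by rewrite lt_min; apply/andP; split; lra.
have d'1 : d' <= d / 2 by rewrite /d' ge_min lexx.
have d'2 : d' <= vol (K k) / 3 by rewrite /d' ge_min lexx orbT.
have [j js|L [LP Lx Ld]] := IH d' d'0; first by apply: KP; rewrite inE js orbT.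
pose S := \big[setU/set0]_(j <- s) L j.
have cS : compact S.
  rewrite /S big_seq; apply: bigsetU_compact => j js.
  by have [] := LP j js.
have LS j : j \in s -> L j `<=` S.
  by move=> js; rewrite /S -bigcup_seq; apply: bigcup_sup.
have fS := compact_finite_volume cS.
have cxS y : compact (left_translate y S) by exact: left_translate_compact.
have fxS y : finite_volume (left_translate y S) by exact: compact_finite_volume.
have vxS y : vol (left_translate y S) <= d'.
  by rewrite vol_left_translate//; exact: fS.1.
pose T := left_translate x S `|` left_translate x^-1 S.
have [||M [cM MK MT M0]] := @compact_avoiding (K k) T cKk.
- exact: compactU.
- have := volU_le (fxS x) (fxS x^-1%g); have := vxS x; have := vxS x^-1%g.
  rewrite -/T; lra.
have d2 : 0 < d / 2 by lra.
have [N [cN NM N0 Nd Nx]] := compact_moved_piece x1 d2 cM M0.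
have NT : N `&` T = set0.
  by rewrite -subset0 => t [/NM Mt Tt]; exact: (disjointF MT Mt Tt).
have NxS : N `&` left_translate x S = set0.
  rewrite -subset0 => t [Nt St].
  have Tt : T t by left.
  exact: (disjointF NT Nt Tt).
have SxN : S `&` left_translate x N = set0.
  apply: left_translateV; rewrite -subset0 => t [Nt St].
  have Tt : T t by right.
  exact: (disjointF NT Nt Tt).
have fN := compact_finite_volume cN.
pose L' j := if j == k then N else L j.
exists L'; split.
- move=> j; rewrite inE /L'; case: eqVneq => [-> _|_ /= js]; last exact: LP.
  by split=> //; exact: subset_trans NM MK.
- move=> i j; rewrite !inE /L'.
  case: (eqVneq i k) => [_ _|_ /= si]; case: (eqVneq j k) => [_ _|_ /= sj] //.
  + rewrite -subset0 => t [Nt [u Lu ut]].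
    have St : left_translate x S t by exists u => //; exact: LS sj _ Lu.
    exact: (disjointF NxS Nt St).
  + rewrite -subset0 => t [Lt xNt].
    exact: (disjointF SxN (LS _ si _ Lt) xNt).
  + exact: Lx.
- have cL' : compact (\big[setU/set0]_(j <- k :: s) L' j).
    rewrite big_seq; apply: bigsetU_compact => j; rewrite inE /L'.
    by case: eqVneq => [//|_ /= js]; have [] := LP j js.
  have sub : \big[setU/set0]_(j <- k :: s) L' j `<=` N `|` S.
    rewrite -bigcup_seq => t [j /=]; rewrite inE /L'.
    by case: eqVneq => [_ _ Nt|_ /= js Lt]; [left|right; exact: LS js _ Lt].
  have := le_vol (compact_borel cL') (finite_volumeU fN fS) sub.
  have := volU_le fN fS; rewrite -/S in Ld; lra.
Qed.

(** * Pieces with prescribed proportions *)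

(** A discrete intermediate value argument: removing W_(n-1), ..., W_0 from A
    one after the other brings its measure down to 0 in steps smaller than d,
    so that some stage falls in the interval from t - d to t. *)
Lemma sized_subset (n : nat) (W : nat -> set G) (A : set G) (t d : R) :
  (forall i, finite_volume (W i) /\ vol (W i) < d) ->
  finite_volume A -> A `<=` \big[setU/set0]_(i < n) W i ->
  0 < d -> 0 <= t <= vol A ->
  exists B, [/\ finite_volume B, B `<=` A & t - d <= vol B <= t].
Proof.
move=> WP + + d0; elim: n A => [|n IH] A fA AW /andP[t0 tA].
  move: AW; rewrite big_ord0 subset0 => A0; exists A; split=> //.
  by move: tA; rewrite A0 vol0 => tA; apply/andP; split; lra.
have [fWn Wnd] := WP n.
have fAW := finite_volumeD fA fWn.1.
have vA := volDI fA fWn.1.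
have vAW := le_vol (finite_volumeI fA fWn.1).1 fWn (@subIsetr _ _ _).
have [tle|tgt] := leP t (vol (A `\` W n)).
  have [||B [fB BA Bt]] := IH _ fAW _ _.
  - move=> u [/AW]; rewrite big_ord_recr /= => -[//|? ?].
    by [].
  - by rewrite t0.
  - by exists B; split=> //; apply: subset_trans BA _; exact: subDsetl.
exists (A `\` W n); split; [by []|by move=> u []|].
by apply/andP; split; lra.
Qed.

Lemma compact_sized_piece (K : set G) (t d : R) : compact K -> 0 < d ->
  0 <= t <= vol K ->
  exists L, [/\ compact L, L `<=` K & `|vol L - t| <= d].
Proof.
move=> cK d0 tK; have d2 : 0 < d / 2 by lra.
have fK := compact_finite_volume cK.
have [p|n [W [WP KW]]] := finite_cover cK (P := fun W =>
    finite_volume W /\ vol W < d / 2).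
  by have [W [oW Wp fW Wd]] := small_nbhs p d2; exists W.
have [B [fB BK /andP[B1 B2]]] := sized_subset WP fK KW d2 tK.
have [L [cL LB Le]] := inner_approx fB d2.
exists L; split=> //; first exact: subset_trans LB BK.
have := le_vol (compact_borel cL) fB LB.
by rewrite ler_norml => ?; apply/andP; split; lra.
Qed.

End HaarPieces.

(** Volumes s_j close to a lam_j, relative to a, have proportions close to
    lam_j.  The tolerance is divided by 2 (#|J| + 1) because the errors of all
    the s_j enter the total, which stays above a / 2. *)
Lemma proportions_close (R : realType) (J : finType) (lam s : J -> R)
    (a e : R) :
  0 < a -> 0 < e -> e <= 1 -> (forall j, 0 <= lam j) -> \sum_j lam j = 1 ->
  (forall j, `|s j - a * lam j| <= a * (e / (2 * (#|J|%:R + 1)))) ->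
  0 < \sum_j s j /\
  forall j, `|s j / (\sum_i s i) - lam j| <= e.
Proof.
move=> a0 e0 e1 lam0 lam1 sP.
set n : R := #|J|%:R; set eta := e / (2 * (n + 1)).
have n0 : 0 <= n by exact: ler0n.
have n1 : n + 1 != 0 by apply: lt0r_neq0; lra.
have etaE : eta * (n + 1) = e / 2 by rewrite /eta; field; lra.
have eta0 : 0 < eta by rewrite divr_gt0//; lra.
have sa : `|\sum_j s j - a| <= a * eta * n.
  have -> : \sum_j s j - a = \sum_j (s j - a * lam j).
    by rewrite sumrB -mulr_sumr lam1 mulr1.
  apply: (le_trans (ler_norm_sum _ _ _)).
  have -> : a * eta * n = \sum_(j : J) a * eta.
    by rewrite sumr_const -mulr_natr.
  by apply: ler_sum => j _; exact: sP.
set S := \sum_j s j in sa *.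
have ae : a * eta * n <= a * (e / 2).
  by rewrite -mulrA; apply: ler_wpM2l; [lra|rewrite -etaE; nra].
have aS : a / 2 <= S by move: sa; rewrite ler_norml => /andP[? _]; nra.
have S0 : 0 < S by lra.
split=> // j.
have lj1 : lam j <= 1.
  by rewrite -lam1 (bigD1 j)//= lerDl sumr_ge0.
have -> : s j / S - lam j = ((s j - a * lam j) + lam j * (a - S)) / S.
  by field; rewrite gt_eqF.
rewrite normrM normfV (gtr0_norm S0) ler_pdivrMr//.
apply: (le_trans (ler_normD _ _)).
have h1 := sP j; rewrite -/n -/eta in h1.
have h2 : `|lam j * (a - S)| <= a * eta * n.
  rewrite normrM (ger0_norm (lam0 j)) distrC.
  by apply: le_trans sa; rewrite ler_piMl.
have : a * eta + a * eta * n = a * (e / 2) by rewrite -etaE; ring.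
nra.
Qed.

(** Take a > 0 at most the volume of every moved piece L_j of positive weight.
    As lam_j <= 1, each L_j can be cut down to volume close to a lam_j. *)
Lemma proportional_pieces (R : realType) (G : topologicalGroupType)
    (m : {measure set (borel G) -> \bar R}) (x : G) (J : finType)
    (E : J -> set G) (lam : J -> R) (d : R) :
  hausdorff_space G -> left_haar m -> ~ (forall A : set G, open A) ->
  x <> 1%g -> 0 < d ->
  (forall j, 0 <= lam j) -> \sum_j lam j = 1 ->
  (forall j, 0 < lam j -> exists K, [/\ compact K, K `<=` E j & 0 < vol m K]) ->
  exists S : J -> set G,
    [/\ forall j, compact (S j) /\ S j `<=` E j,
        forall i j, S i `&` left_translate x (S j) = set0,
        0 < \sum_j vol m (S j)
      & forall j, `|vol m (S j) / (\sum_i vol m (S i)) - lam j| <= d].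
Proof.
move=> G_hausdorff m_haar G_not_discrete x1 d0 lam0 lam1 EK.
have /choice[K KP] : forall j, exists K, 0 < lam j ->
    [/\ compact K, K `<=` E j & 0 < vol m K].
  by move=> j; case: (pselect (0 < lam j)) => [/EK[K ?]|?];
    [exists K|exists set0].
pose s := enum [pred j | 0 < lam j].
have sE j : (j \in s) = (0 < lam j) by rewrite mem_enum inE.
have [|j|L [LP Lx _]] := @compact_pieces_moved _ _ m G_hausdorff m_haar
  G_not_discrete x J s K 1 x1.
- exact: ltr01.
- by rewrite sE => /KP[].
pose a := \big[Num.min/1]_(j | 0 < lam j) vol m (L j).
have a0 : 0 < a.
  by apply: lt_bigmin => // j lj; have [|] := LP j; rewrite ?sE.
have aL j : 0 < lam j -> a <= vol m (L j) by exact: bigmin_le_cond.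
pose e := Num.min d 1.
have e0 : 0 < e by rewrite lt_min d0 ltr01.
have e1 : e <= 1 by rewrite /e ge_min lexx orbT.
have ed : e <= d by rewrite /e ge_min lexx.
pose eta := a * (e / (2 * (#|J|%:R + 1))).
have eta0 : 0 < eta.
  by rewrite mulr_gt0// divr_gt0// mulr_gt0// ltr_wpDl// ler0n.
(* Cells of weight 0 contribute the empty set. *)
have /choice[S SP] : forall j, exists S, [/\ compact S, S `<=` E j,
    S !=set0 -> 0 < lam j /\ S `<=` L j & `|vol m S - a * lam j| <= eta].
  move=> j; have [lj|lj] := ltP 0 (lam j); last first.
    exists set0; split=> //; first exact: compact0.
      by case.
    have -> : lam j = 0 by apply/eqP; rewrite eq_le lj lam0.
    by rewrite vol0 mulr0 subr0 normr0 ltW.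
  have [cL LK Lj0] : [/\ compact (L j), L j `<=` K j & 0 < vol m (L j)].
    by apply: LP; rewrite sE.
  have lj1 : lam j <= 1 by rewrite -lam1 (bigD1 j)//= lerDl sumr_ge0.
  have [|S [cS SL Seta]] := compact_sized_piece G_hausdorff m_haar
    G_not_discrete (t := a * lam j) cL eta0.
    have := aL _ lj; move: lj1 lj a0 => *; apply/andP; split; nra.
  exists S; split=> //; have [_ KE _] := KP _ lj.
  by apply: subset_trans SL _; exact: subset_trans LK KE.
have Seta j : `|vol m (S j) - a * lam j| <= eta by have [] := SP j.
have [Spos Sprop] := proportions_close a0 e0 e1 lam0 lam1 Seta.
exists S; split=> //.
- by move=> j; have [] := SP j.
- move=> i j; rewrite -subset0 => t [Sit [u Sju ut]].
  have [_ _ /(_ (ex_intro _ t Sit))[li SLi] _] := SP i.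
  have [_ _ /(_ (ex_intro _ u Sju))[lj SLj] _] := SP j.
  rewrite -sE in li; rewrite -sE in lj.
  have xLt : left_translate x (L j) t by exists u => //; exact: SLj.
  exact: (disjointF (Lx _ _ li lj) (SLi _ Sit) xLt).
- by move=> j; exact: le_trans (Sprop j) ed.
Qed.

(** * Partitions on which bounded functions oscillate little *)

Section LocallyBorel.
Context {R : realType} {G : topologicalGroupType}.
Variable m : {measure set (borel G) -> \bar R}.

(** Level sets of locally measurable functions need not be Borel; only their
    traces on Borel sets of finite measure are. *)
Definition locally_borel (E : set G) : Prop :=
  forall F : set G, measurable (F : set (borel G)) -> (m F < +oo)%E ->
    measurable (F `&` E : set (borel G)).

Lemma locally_borelT : locally_borel setT.
Proof. by move=> F mF _; rewrite setIT. Qed.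

Lemma locally_aeW (P Q : G -> Prop) :
  (forall t, P t -> Q t) -> locally_ae m P -> locally_ae m Q.
Proof.
by move=> PQ; apply: locally_null_sub => t /= nQ Pt; apply: nQ; exact: PQ.
Qed.

Lemma locally_ae_all (P : G -> Prop) : (forall t, P t) -> locally_ae m P.
Proof.
move=> Pall F _ _; rewrite (_ : _ `&` F = set0); first exact: negligible_set0.
by rewrite -subset0 => t [/= nP _]; exact: nP.
Qed.

Lemma locally_aeI (P Q : G -> Prop) : locally_ae m P -> locally_ae m Q ->
  locally_ae m (fun t => P t /\ Q t).
Proof.
move=> aeP aeQ; apply: locally_null_sub (locally_null_setU aeP aeQ) => t /=.
by move/not_andP.
Qed.

Lemma locally_ae_witness (E : set G) (P : G -> Prop) :
  ~ locally_null m E -> locally_ae m P -> exists2 t, E t & P t.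
Proof.
move=> En aeP; apply: contrapT => /forall2NP EP; apply: En.
apply: locally_null_sub aeP => t Et /=.
by have [|] := EP t.
Qed.

Lemma compact_in_nonnull (E : set G) : hausdorff_space G -> left_haar m ->
  locally_borel E -> ~ locally_null m E ->
  exists K, [/\ compact K, K `<=` E & 0 < vol m K].
Proof.
move=> G_hausdorff m_haar bE /existsNP[F /not_implyP[mF /not_implyP[Foo EF0]]].
have fFE : finite_volume m (F `&` E).
  apply: (finite_volumeS (bE F mF Foo) (conj mF Foo)); exact: subIsetl.
have v0 : 0 < vol m (F `&` E).
  rewrite lt_neqAle vol_ge0 andbT eq_sym; apply/eqP => v0; apply: EF0.
  have m0 : m (F `&` E) = 0%E by rewrite (volE fFE) v0.
  by rewrite setIC; apply/negligibleP; [exact: fFE.1|exact: m0].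
have [K [cK KFE Ke]] := inner_approx G_hausdorff m_haar fFE v0.
exists K; split=> //; last lra.
by move=> t /KFE[].
Qed.

(** The cells cover only locally almost everywhere: a function of L_oo is
    bounded only there, and finitely many slices miss its other values. *)
Definition cell_partition (J : finType) (E : J -> set G) : Prop :=
  [/\ forall j, locally_borel (E j),
      forall i j t, E i t -> E j t -> i = j
    & locally_ae m (fun t => exists j, E j t)].

(** The cells are cut along the values of f in the half-open intervals
    [(k - N) e, (k + 1 - N) e[ with k < 2 N, which cover [-M, M]. *)
Lemma refine_partition (J : finType) (E : J -> set G) (f : G -> R) (M e : R) :
  0 < e -> cell_partition E -> locally_measurable m f ->
  locally_ae m (fun t => `|f t| <= M) ->
  exists (J' : finType) (E' : J' -> set G),
    [/\ cell_partition E', forall j', exists j, E' j' `<=` E j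
      & forall j' s t, E' j' s -> E' j' t -> `|f s - f t| <= e].
Proof.
move=> e0 [bE dE cE] mf fM.
have M0 : 0 <= `|M| / e by rewrite divr_ge0// ltW.
pose N := Num.bound (`|M| / e).
have MN : `|M| < N%:R * e by rewrite -ltr_pdivrMr//; exact: archi_boundP.
pose lo (k : nat) : R := (k%:R - N%:R) * e.
pose Y (k : nat) : set R := `[lo k, lo k.+1[%classic.
have YP k u : Y k u -> lo k <= u < lo k.+1 by rewrite /Y /= in_itv.
have loS k : lo k.+1 = lo k + e by rewrite /lo -natr1; ring.
exists (J * 'I_(N + N))%type,
  (fun p : J * 'I_(N + N) => E p.1 `&` f @^-1` Y p.2).
split; [split| |].
- move=> [j k] F mF Foo /=; rewrite setIA setIAC.
  have mY : measurable (F `&` f @^-1` Y k : set (borel G)).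
    exact: (mf F mF Foo mF _ (measurable_itv _)).
  apply: bE => //.
  exact: (finite_volumeS mY (conj mF Foo) (@subIsetl _ _ _)).2.
- move=> [i k] [j l] t [/= Ei /YP/andP[k1 k2]] [/= Ej /YP/andP[l1 l2]].
  have lt_lo (a b : nat) : lo a < lo b.+1 -> (a <= b)%N.
    by rewrite /lo ltr_pM2r// ltrD2r ltr_nat.
  congr (_, _); first exact: dE Ei Ej.
  apply: val_inj; apply/eqP; rewrite /= eqn_leq.
  by rewrite !lt_lo// ?(le_lt_trans k1)// (le_lt_trans l1).
- apply: locally_aeW (locally_aeI cE fM) => t [[j Ej] ftM].
  have := le_lt_trans (le_trans ftM (ler_norm M)) MN.
  rewrite ltr_norml => /andP[f1 f2].
  have h0 : 0 <= f t / e + N%:R.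
    by rewrite -(@ler_pM2r _ e)// mul0r mulrDl mulfVK ?gt_eqF//; lra.
  pose k := Num.truncn (f t / e + N%:R).
  have /andP[k1 k2] := truncn_itv h0.
  have kN : (k < N + N)%N.
    rewrite -(ltr_nat R) natrD; apply: le_lt_trans k1 _.
    by rewrite ltrD2r ltr_pdivrMr.
  exists (j, Ordinal kN); split=> //=.
  rewrite /Y /= in_itv /=; apply/andP; split.
    by rewrite /lo -ler_pdivlMr// lerBlDr.
  by rewrite /lo -ltr_pdivrMr// ltrBrDr.
- by move=> [j k]; exists j => t [].
- move=> [j k] s t [/= _ /YP/andP[s1 s2]] [/= _ /YP/andP[t1 t2]].
  by move: s2 t2; rewrite loS ler_norml => *; apply/andP; split; lra.
Qed.

End LocallyBorel.

Section ComplexNorm.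
Context {R : realType}.

Lemma normc_le_ReIm (z : R[i]) :
  `|z| <= (`|complex.Re z| + `|complex.Im z|)%:C.
Proof.
rewrite normc_def lecR -[leRHS]ger0_norm ?addr_ge0// -sqrtr_sqr ler_wsqrtr//.
rewrite sqrrD !real_normK ?num_real// addrAC lerDl.
by rewrite mulrn_wge0// mulr_ge0.
Qed.

Lemma Im_le_normc (z : R[i]) : `|complex.Im z|%:C <= `|z|.
Proof.
rewrite normc_def lecR -sqrtr_sqr ler_wsqrtr// lerDr sqr_ge0//.
Qed.

End ComplexNorm.

Section LinftyCells.
Context {R : realType} {G : topologicalGroupType}.
Variable m : {measure set (borel G) -> \bar R}.

Lemma Linfty_measurable (phi : Linfty m) :
  locally_measurable m (fun t => complex.Re (phi t)) /\
  locally_measurable m (fun t => complex.Im (phi t)).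
Proof. by case: phi => f /=; rewrite inE => -[]. Qed.

Lemma Linfty_bounded (phi : Linfty m) : exists M : R, ess_bound m phi M.
Proof. by case: phi => f /=; rewrite inE => -[]. Qed.

Lemma Linfty_partition (n : nat) (phi : nat -> Linfty m) (e : R) : 0 < e ->
  exists (J : finType) (E : J -> set G), cell_partition m E /\
    forall i j s t, (i < n)%N -> E j s -> E j t ->
      `|phi i s - phi i t| <= e%:C.
Proof.
move=> e0; have e2 : 0 < e / 2 by lra.
elim: n => [|n [J [E [PE osc]]]].
  exists unit, (fun=> setT); split=> //; split.
  - by move=> _; exact: locally_borelT.
  - by move=> [] [].
  - by apply: locally_ae_all => t; exists tt.
have [mr mi] := Linfty_measurable (phi n).
have [M phiM] := Linfty_bounded (phi n).
have rM : locally_ae m (fun t => `|complex.Re (phi n t)| <= M).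
  apply: locally_aeW phiM => t tM; rewrite -lecR.
  exact: le_trans (normc_ge_Re _) tM.
have iM : locally_ae m (fun t => `|complex.Im (phi n t)| <= M).
  apply: locally_aeW phiM => t tM; rewrite -lecR.
  exact: le_trans (Im_le_normc _) tM.
have [J1 [E1 [PE1 sub1 osc1]]] := refine_partition e2 PE mr rM.
have [J2 [E2 [PE2 sub2 osc2]]] := refine_partition e2 PE1 mi iM.
exists J2, E2; split=> // i j s t; rewrite ltnS leq_eqVlt.
have [j1 sub21] := sub2 j; have [j0 sub10] := sub1 j1.
move=> /predU1P[->|ilt] Es Et; last first.
  by apply: osc ilt _ _; apply: sub10; apply: sub21; [exact: Es|exact: Et].
apply: (le_trans (normc_le_ReIm _)); rewrite lecR.
have := osc1 _ _ _ (sub21 _ Es) (sub21 _ Et); have := osc2 _ _ _ Es Et.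
rewrite !raddfB /=; lra.
Qed.

Lemma indic_in_Linfty (E : set G) : locally_borel m E ->
  (fun t => (\1_E t)%:C : R[i]^o) \in in_Linfty m.
Proof.
move=> bE; rewrite inE /=; split.
- move=> F mF Foo.
  have mFE : measurable_fun (F : set (borel G)) (\1_(F `&` E) : borel G -> R).
    by apply: measurable_funTS; apply: measurable_indic; exact: bE.
  apply: eq_measurable_fun mFE => t tF.
  by rewrite /= !indicE in_setI tF.
- by move=> F mF Foo; exact: measurable_cst.
- exists 1; apply: locally_ae_all => t.
  rewrite normc_def lecR /= expr0n /= addr0 sqrtr_sqr indicE.
  by case: (t \in E); rewrite ?normr1 ?normr0 ?ler01.
Qed.

Definition Linfty_indic (E : set G) (bE : locally_borel m E) : Linfty m :=
  MkLinfty (indic_in_Linfty bE).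

Lemma cell_borel (J : finType) (E : J -> set G) (j : J) :
  cell_partition m E -> locally_borel m (E j).
Proof. by case. Qed.

Definition cell_indic (J : finType) (E : J -> set G) (PE : cell_partition m E)
  (j : J) : Linfty m := Linfty_indic (cell_borel j PE).

Definition Linfty_one : Linfty m := Linfty_indic (@locally_borelT R G m).

Lemma Linfty_sumE (I : Type) (s : seq I) (F : I -> Linfty m) (t : G) :
  (\sum_(i <- s) F i) t = \sum_(i <- s) F i t.
Proof. by elim/big_rec2: _ => // i a b _ <-. Qed.

Lemma ess_boundS (phi : Linfty m) (M N : R) :
  M <= N -> ess_bound m phi M -> ess_bound m phi N.
Proof.
by move=> MN; apply: locally_aeW => t tM; apply: (le_trans tM); rewrite lecR.
Qed.

Lemma Linfty_norm_le (phi : Linfty m) (M : R) :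
  0 <= M -> ess_bound m phi M -> Linfty_norm phi <= M.
Proof. by move=> M0 phiM; apply: ge_inf; [exists 0 => ? []|split]. Qed.

Lemma ess_bound_norm (phi : Linfty m) (d : R) :
  0 < d -> ess_bound m phi (Linfty_norm phi + d).
Proof.
move=> d0; have [M phiM] := Linfty_bounded phi.
have [|N [N0 phiN] /ltW Nd] := @inf_adherent R
    [set M : R | 0 <= M /\ ess_bound m phi M] d d0.
- split; last by exists 0 => ? [].
  exists `|M|; split=> //; apply: ess_boundS phiM; exact: ler_norm.
- exact: ess_boundS Nd phiN.
Qed.

End LinftyCells.

(** * Weights that a mean gives to the cells *)

Section Means.
Context {R : realType} {G : topologicalGroupType}.
Variable m : {measure set (borel G) -> \bar R}.
Variable mu : {linear Linfty m -> R[i]^o}.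
Hypothesis mu_mean : mean mu.

(** This is the inequality |mu phi| <= ||phi||, rescaled from the unit ball
    because the norm of mu is a supremum over it. *)
Lemma mean_le_bound (phi : Linfty m) (e : R) :
  0 < e -> ess_bound m phi e -> `|mu phi| <= e%:C.
Proof.
move=> e0 phie; have [mu1 _] := mu_mean.
pose psi := (e^-1)%:C *: phi.
have ec0 : (0 : R[i]) < e%:C by rewrite ltcR.
have psi1 : Linfty_norm psi <= 1.
  apply: Linfty_norm_le => //; apply: locally_aeW phie => t te.
  change (`|(e^-1)%:C * phi t| <= 1%:C).
  rewrite normrM fmorphV normfV (gtr0_norm ec0) mulrC ler_pdivrMr//.
  by rewrite mul1r.
have : ((complex.Re `|mu psi|)%:E <= 1)%E.
  by rewrite -mu1; apply: ereal_sup_ubound; exists psi.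
rewrite lee_fin /psi linearZ /= => h.
have : `|(e^-1)%:C * mu phi| <= 1.
  have : (complex.Re `|(e^-1)%:C * mu phi|)%:C <= 1%:C by rewrite lecR.
  by rewrite RRe_real ?normr_real.
rewrite normrM fmorphV normfV (gtr0_norm ec0) mulrC ler_pdivrMr//.
by rewrite mul1r.
Qed.

Lemma mean_indic_ge0 (E : set G) (bE : locally_borel m E) :
  0 <= mu (Linfty_indic bE).
Proof.
have [_ mupos] := mu_mean; apply: mupos; apply: locally_ae_all => t /=.
by rewrite ler0c indicE ler0n.
Qed.

Lemma mean_indic_nonnull (E : set G) (bE : locally_borel m E) :
  mu (Linfty_indic bE) != 0 -> ~ locally_null m E.
Proof.
move=> /negP muE nE; apply: muE; rewrite eq_le mean_indic_ge0 andbT.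
have [_ mupos] := mu_mean; rewrite -oppr_ge0 -linearN /=; apply: mupos.
apply: locally_null_sub nE => t /= nt; apply: contrapT => tE; apply: nt.
change (0 <= - (\1_E t)%:C :> R[i]).
by rewrite indicE memNset// oppr0.
Qed.

(** Locally almost everywhere phi differs by at most e from the simple function
    with value c_j on E_j, and mu has norm 1. *)
Lemma mean_simple_approx (J : finType) (E : J -> set G)
    (PE : cell_partition m E) (phi : Linfty m) (c : J -> R[i]) (e : R) :
  0 < e ->
  (forall j t, E j t -> `|phi t - c j| <= e%:C) ->
  `|mu phi - \sum_j c j * mu (cell_indic PE j)| <= e%:C.
Proof.
move=> e0 phic.
have -> : mu phi - \sum_j c j * mu (cell_indic PE j) =
    mu (phi - \sum_j c j *: cell_indic PE j).
  rewrite linearB (linear_sum mu); apply: (congr1 (fun z : R[i] => mu phi - z)).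
  by apply: eq_bigr => j _; rewrite linearZ.
apply: mean_le_bound => //; have [_ dE cE] := PE.
apply: locally_aeW cE => t [j Ejt].
change (`|phi t - (\sum_j c j *: cell_indic PE j) t| <= e%:C).
rewrite Linfty_sumE (bigD1 j)//= big1 => [|i ij].
  rewrite addr0; change (`|phi t - c j * (\1_(E j) t)%:C| <= e%:C).
  by rewrite indicE mem_set// mulr1; exact: phic.
change (c i * (\1_(E i) t)%:C = 0).
rewrite indicE memNset ?mulr0// => Eit.
by move: ij; rewrite (dE _ _ _ Eit Ejt) eqxx.
Qed.

(** The constant 1 is a simple function on every partition, so that the
    approximation error is below every e > 0. *)
Lemma sum_cell_weights (J : finType) (E : J -> set G)
    (PE : cell_partition m E) :
  \sum_j mu (cell_indic PE j) = mu (Linfty_one m).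
Proof.
apply/esym/eqP; rewrite -subr_eq0 -normr_eq0; apply/negPn/negP => N0.
set z := `|_| in N0.
have z0 : 0 < z by rewrite lt_neqAle eq_sym N0 normr_ge0.
have zE : z = (complex.Re z)%:C by rewrite RRe_real// gtr0_real.
have rz0 : 0 < complex.Re z by rewrite -ltcR -zE.
have rz2 : 0 < complex.Re z / 2 by lra.
have := @mean_simple_approx J E PE (Linfty_one m) (fun=> 1) _ rz2.
under eq_bigr do rewrite mul1r.
rewrite -/z zE lecR => h.
suff : complex.Re z <= complex.Re z / 2 by lra.
apply: h => j t _; change (`|(\1_[set: G] t)%:C - 1| <= (complex.Re z / 2)%:C).
by rewrite indicE mem_set// subrr normr0 ler0c ltW.
Qed.

(** On a cell of nonzero weight phi takes a value of modulus at most 1 + d,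
    because the cell is not locally null; up to d, mu phi is thus a combination
    of the weights with coefficients of modulus at most 1 + d. *)
Lemma mean_le_one (phi : Linfty m) (d : R) : 0 < d -> Linfty_norm phi <= 1 ->
  `|mu phi| <= d%:C + (1 + d)%:C * mu (Linfty_one m).
Proof.
move=> d0 phi1.
have [J [E [PE osc]]] := Linfty_partition 1 (fun=> phi) d0.
have phid : ess_bound m phi (1 + d).
  by apply: ess_boundS (ess_bound_norm phi d0); rewrite lerD2r.
have /choice[c cP] : forall j, exists c : R[i],
    (forall t, E j t -> `|phi t - c| <= d%:C) /\
    `|c * mu (cell_indic PE j)| <= (1 + d)%:C * mu (cell_indic PE j).
  move=> j; have muj0 := mean_indic_ge0 (cell_borel j PE).
  have [mu0|muN0] := eqVneq (mu (cell_indic PE j)) 0.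
    have [[t Et]|E0] := pselect (exists t, E j t).
      exists (phi t); split; first by move=> s Es; exact: (osc 0%N j).
      by rewrite mu0 !mulr0 normr0.
    exists 0; split; first by move=> t Et; case: E0; exists t.
    by rewrite mu0 !mulr0 normr0.
  have [t Et phit] := locally_ae_witness (mean_indic_nonnull muN0) phid.
  exists (phi t); split; first by move=> s Es; exact: (osc 0%N j).
  by rewrite normrM (ger0_norm muj0) ler_wpM2r.
have := mean_simple_approx PE d0 (fun j => (cP j).1).
set z := \sum_j _ => muz.
have zle : `|z| <= (1 + d)%:C * mu (Linfty_one m).
  rewrite -(sum_cell_weights PE) mulr_sumr.
  apply: (le_trans (ler_norm_sum _ _ _)); apply: ler_sum => j _.
  exact: (cP j).2.
rewrite -(subrK z (mu phi)); apply: (le_trans (ler_normD _ _)).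
exact: lerD.
Qed.

(** If v = mu 1 were less than 1, then |mu phi| <= d + (1 + d) v would stay
    away from 1 on the unit ball for small d, against the norm of mu. *)
Lemma mean_one : mu (Linfty_one m) = 1.
Proof.
have mu1ge0 : 0 <= mu (Linfty_one m) := mean_indic_ge0 (@locally_borelT _ _ m).
have mu1E : mu (Linfty_one m) = (complex.Re (mu (Linfty_one m)))%:C.
  by rewrite RRe_real// ger0_real.
set v := complex.Re _ in mu1E.
have v1 : v <= 1.
  rewrite -lecR -mu1E -(ger0_norm mu1ge0); apply: mean_le_bound => //.
  apply: locally_ae_all => t; change (`|(\1_[set: G] t)%:C| <= 1%:C :> R[i]).
  by rewrite indicE mem_set// normr1.
suff v1' : 1 <= v.
  by rewrite mu1E; have -> : v = 1 by apply/eqP; rewrite eq_le v1.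
rewrite leNgt; apply/negP => vlt.
(* The bounds give 1 - d < d + (1 + d) v <= 2 d + v, that is 1 - v < 3 d. *)
pose d := (1 - v) / 4; have d0 : 0 < d by rewrite /d; lra.
have [normmu _] := mu_mean.
have : ((1 - d)%:E < functional_norm mu)%E by rewrite normmu lte_fin; lra.
move=> /ereal_sup_gt[_ [phi phi1 <-]]; rewrite lte_fin.
have := mean_le_one d0 phi1; rewrite mu1E -rmorphM -rmorphD /=.
rewrite -(RRe_real (normr_real (mu phi))) lecR => h1 h2.
have : (1 + d) * v <= v + d by nra.
have := lt_le_trans h2 h1.
have : 4 * d = 1 - v by rewrite /d; field.
move: ((1 + d) * v) => w; lra.
Qed.

End Means.

(** * Averages over a compact set *)

Section Averages.
Context {R : realType} {G : topologicalGroupType}.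
Variable m : {measure set (borel G) -> \bar R}.
Implicit Types (A : set G) (f : G -> R).

Lemma integrable_bounded A f (B : R) : finite_volume m A ->
  locally_measurable m f -> (forall t, A t -> `|f t| <= B) ->
  m.-integrable (A : set (borel G)) (EFin \o f).
Proof.
move=> fA mf fB; apply: measurable_bounded_integrable.
- exact: fA.1.
- exact: fA.2.
- exact: mf fA.1 fA.2.
- exists B; split; first exact: num_real.
  by move=> y By t At /=; apply: (le_trans (fB t At)); exact: ltW.
Qed.

Lemma locally_measurable_cst (r : R) : locally_measurable m (fun _ : G => r).
Proof. by move=> F _ _; exact: measurable_cst. Qed.

Lemma Rintegral_near_cst A f (r e : R) : finite_volume m A ->
  locally_measurable m f -> (forall t, A t -> `|f t - r| <= e) ->
  `|Rintegral m A f - vol m A * r| <= vol m A * e.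
Proof.
move=> fA mf fr.
have If : m.-integrable (A : set (borel G)) (EFin \o f).
  apply: (@integrable_bounded A f (`|r| + e)) => // t /fr tr.
  by rewrite -(subrK r (f t)) addrC (le_trans (ler_normD _ _))// lerD2l.
have Ic (k : R) : m.-integrable (A : set (borel G)) (EFin \o (fun=> k)).
  by apply: (@integrable_bounded A _ `|k|) => //; exact: locally_measurable_cst.
have lo : Rintegral m A (fun=> r - e) <= Rintegral m A f.
  apply: le_Rintegral => //; first exact: fA.1.
  by move=> t /fr; rewrite ler_norml => /andP[? _]; lra.
have hi : Rintegral m A f <= Rintegral m A (fun=> r + e).
  apply: le_Rintegral => //; first exact: fA.1.
  by move=> t /fr; rewrite ler_norml => /andP[_ ?]; lra.
have cst k : Rintegral m A (fun=> k) = vol m A * k.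
  by have mA := fA.1; rewrite Rintegral_cst// mulrC.
move: lo hi; rewrite !cst ler_norml => *; apply/andP; split; lra.
Qed.

Lemma Rintegral_pieces (J : choiceType) (s : seq J) (S : J -> set G) f
    (r : J -> R) (e : R) : uniq s ->
  (forall j, finite_volume m (S j)) ->
  (forall i j, i != j -> S i `&` S j = set0) -> locally_measurable m f ->
  m.-integrable (\big[setU/set0]_(j <- s) S j : set (borel G)) (EFin \o f) ->
  (forall j t, S j t -> `|f t - r j| <= e) ->
  `|Rintegral m (\big[setU/set0]_(j <- s) S j) f
    - \sum_(j <- s) vol m (S j) * r j| <= (\sum_(j <- s) vol m (S j)) * e.
Proof.
move=> + fS dS mf + fr; elim: s => [_|k s IH /= /andP[ks us] If].
  by rewrite !big_nil Rintegral_set0 subrr normr0 mul0r.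
have fs := finite_volume_bigsetU s fS.
have kS : S k `&` \big[setU/set0]_(j <- s) S j = set0.
  rewrite -subset0 => t [Skt]; rewrite -bigcup_seq => -[j /= js Sjt].
  have kj : k != j by apply: contraNneq ks => ->.
  exact: (disjointF (dS _ _ kj) Skt Sjt).
rewrite !big_cons in If *.
rewrite Rintegral_setU//; first last.
- by apply/disj_setPS; rewrite kS.
- exact: fs.1.
- exact: (fS k).1.
rewrite opprD addrACA mulrDl (le_trans (ler_normD _ _))// lerD//.
  by apply: Rintegral_near_cst => //; exact: fr.
apply: IH => //; apply: integrableS If; first exact: measurableU (fS k).1 fs.1.
  exact: fs.1.
exact: subsetUr.
Qed.

Lemma average_pieces (J : finType) (S : J -> set G) f (r : J -> R) (e : R) :
  (forall j, finite_volume m (S j)) ->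
  (forall i j, i != j -> S i `&` S j = set0) ->
  0 < \sum_j vol m (S j) -> locally_measurable m f ->
  (forall j t, S j t -> `|f t - r j| <= e) ->
  `|Rintegral m setT (fun t => \1_(\big[setU/set0]_j S j) t /
        vol m (\big[setU/set0]_j S j) * f t)
     - \sum_j vol m (S j) / (\sum_i vol m (S i)) * r j| <= e.
Proof.
move=> fS dS s0 mf fr.
have uJ : uniq (index_enum J) by exact: index_enum_uniq.
rewrite (vol_bigsetU uJ fS dS); set s := \sum_i vol m (S i) in s0 *.
set A := \big[setU/set0]_j S j.
have fA : finite_volume m A by exact: finite_volume_bigsetU.
have If : m.-integrable (A : set (borel G)) (EFin \o f).
  apply: (@integrable_bounded A f (\sum_j `|r j| + e)) => // t.
  rewrite /A -bigcup_seq => -[j _ /fr tr].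
  rewrite -(subrK (r j) (f t)) addrC (le_trans (ler_normD _ _))// lerD//.
  by rewrite (bigD1 j)//= lerDl; apply: sumr_ge0.
have -> : (fun t => \1_A t / s * f t) = (fun t => s^-1 * f t) \_ A.
  apply/funext => t; rewrite patchE indicE.
  by case: (t \in A); rewrite ?mul1r// !mul0r.
rewrite -(@Rintegral_mkcond _ (borel G)) RintegralZl//; last exact: fA.1.
have -> : \sum_j vol m (S j) / s * r j = s^-1 * \sum_j vol m (S j) * r j.
  by rewrite mulr_sumr; apply: eq_bigr => j _; rewrite mulrAC mulrC mulrA.
rewrite -mulrBr normrM (gtr0_norm (_ : 0 < s^-1)) ?invr_gt0//.
rewrite ler_pdivrMl//; exact: (Rintegral_pieces uJ fS dS mf If fr).
Qed.

(** The bound is doubled because real and imaginary parts are estimated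
    separately. *)
Lemma mean_of_set_pieces (J : finType) (S : J -> set G) (phi : Linfty m)
    (c : J -> R[i]) (e : R) :
  (forall j, finite_volume m (S j)) ->
  (forall i j, i != j -> S i `&` S j = set0) ->
  0 < \sum_j vol m (S j) ->
  (forall j t, S j t -> `|phi t - c j| <= e%:C) ->
  `|mean_of_set m (\big[setU/set0]_j S j) phi
    - \sum_j (vol m (S j) / (\sum_i vol m (S i)))%:C * c j| <= (e + e)%:C.
Proof.
move=> fS dS s0 phic; have [mr mi] := Linfty_measurable phi.
set A := \big[setU/set0]_j S j; set s := \sum_i vol m (S i).
have rc j t : S j t -> `|complex.Re (phi t) - complex.Re (c j)| <= e.
  move=> /phic h; rewrite -lecR -raddfB; exact: le_trans (normc_ge_Re _) h.
have ic j t : S j t -> `|complex.Im (phi t) - complex.Im (c j)| <= e.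
  move=> /phic h; rewrite -lecR -raddfB; exact: le_trans (Im_le_normc _) h.
have Re_scale (a : R) (z : R[i]) : complex.Re (a%:C * z) = a * complex.Re z.
  by case: z => u v /=; rewrite mul0r subr0.
have Im_scale (a : R) (z : R[i]) : complex.Im (a%:C * z) = a * complex.Im z.
  by case: z => u v /=; rewrite mul0r addr0.
apply: (le_trans (normc_le_ReIm _)); rewrite lecR lerD//.
- rewrite raddfB raddf_sum /=; under eq_bigr do rewrite Re_scale.
  have := average_pieces fS dS s0 mr rc; rewrite -/A -/s.
  congr (`| _ - _| <= _); congr Rintegral; apply/funext => t.
  by rewrite Re_scale.
- rewrite raddfB raddf_sum /=; under eq_bigr do rewrite Im_scale.
  have := average_pieces fS dS s0 mi ic; rewrite -/A -/s.
  congr (`| _ - _| <= _); congr Rintegral; apply/funext => t.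
  by rewrite Im_scale.
Qed.

End Averages.

(** * Approximation of a mean *)

(** The error splits in four quarters of e: two for replacing phi_i by c_ij in
    the average over S, one for replacing the proportions of S by the weights,
    one for replacing phi_i by c_ij in mu. *)
Lemma mean_of_set_approx (R : realType) (G : topologicalGroupType)
    (m : {measure set (borel G) -> \bar R}) (mu : {linear Linfty m -> R[i]^o})
    (x : G) (n : nat) (phi : nat -> Linfty m) (e : R) :
  hausdorff_space G -> left_haar m -> ~ (forall A : set G, open A) ->
  mean mu -> x <> 1%g -> 0 < e ->
  exists S, [/\ compact_pos m S, S `&` left_translate x S = set0
    & forall i, (i < n)%N -> `|mean_of_set m S (phi i) - mu (phi i)| <= e%:C].
Proof.
move=> G_hausdorff m_haar G_not_discrete mu_mean x1 e0.
have e4 : 0 < e / 4 by lra.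
have [J [E [PE osc]]] := Linfty_partition n phi e4.
have [bE dE _] := PE.
(* The constant c_ij is the value of phi_i at a point p_j of E_j; empty cells
   have weight 0 and get an arbitrary point. *)
have /choice[p pE] : forall j, exists p, forall t, E j t -> E j p.
  move=> j; have [[p Ep]|E0] := pselect (exists p, E j p); first by exists p.
  by exists 1%g => t Et; case: E0; exists t.
pose c i j : R[i] := phi i (p j).
pose lam j := complex.Re (mu (cell_indic PE j)).
have muE j : mu (cell_indic PE j) = (lam j)%:C.
  by rewrite RRe_real// ger0_real//; exact: mean_indic_ge0.
have lam0 j : 0 <= lam j.
  by rewrite -ler0c -muE; exact: mean_indic_ge0.
have lam1 : \sum_j lam j = 1.
  apply: complexI; rewrite rmorph_sum /=.
  under eq_bigr do rewrite -muE.
  by rewrite sum_cell_weights// mean_one.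
(* B bounds all the c_ij at once; d is chosen so that #|J| d B <= e / 4. *)
pose B := \sum_(i < n) \sum_j complex.Re `|c i j|.
have Rec0 i j : 0 <= complex.Re `|c i j|.
  by rewrite -ler0c RRe_real ?normr_real.
have cB i j : (i < n)%N -> `|c i j| <= B%:C.
  move=> ilt; rewrite -(RRe_real (normr_real (c i j))) lecR /B.
  rewrite (bigD1 (Ordinal ilt))//= (bigD1 j)//= -addrA lerDl.
  apply: addr_ge0; apply: sumr_ge0 => k _; first exact: Rec0.
  by apply: sumr_ge0 => l _; exact: Rec0.
have B0 : 0 <= B.
  by apply: sumr_ge0 => i _; apply: sumr_ge0 => j _; exact: Rec0.
have nJ0 : 0 <= #|J|%:R :> R by exact: ler0n.
pose d := e / 4 / ((#|J|%:R + 1) * (B + 1)).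
have d0 : 0 < d by rewrite divr_gt0// mulr_gt0//; lra.
have [j lj|S [SP Sx s0 Slam]] := proportional_pieces (E := E)
    G_hausdorff m_haar G_not_discrete x1 d0 lam0 lam1.
  apply: compact_in_nonnull => //.
  apply: (mean_indic_nonnull mu_mean (bE := bE j)).
  (* The two indicators differ only by the proof that E_j is locally Borel. *)
  rewrite (_ : Linfty_indic _ = cell_indic PE j).
    by rewrite muE; apply/eqP => /complexI lj0; move: lj; rewrite lj0 ltxx.
  by congr Linfty_indic; exact: Prop_irrelevance.
have fS j : finite_volume m (S j).
  by apply: compact_finite_volume => //; have [] := SP j.
have dS i j : i != j -> S i `&` S j = set0.
  move=> ij; rewrite -subset0 => t [/(SP i).2 Ei /(SP j).2 Ej].
  by move: ij; rewrite (dE _ _ _ Ei Ej) eqxx.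
have volS := vol_bigsetU (index_enum_uniq J) fS dS.
exists (\big[setU/set0]_j S j); split.
- split; first by apply: bigsetU_compact => j _; have [] := SP j.
  by rewrite volE ?lte_fin ?volS//; exact: finite_volume_bigsetU.
- rewrite -subset0 => t []; rewrite -bigcup_seq => -[i _ Sit] [u [j _ Sju] ut].
  have xSt : left_translate x (S j) t by exists u.
  exact: (disjointF (Sx i j) Sit xSt).
move=> i ilt.
have oscE j t : E j t -> `|phi i t - c i j| <= (e / 4)%:C.
  by move=> Et; exact: (osc i j t (p j) ilt Et (pE j t Et)).
have oscS j t : S j t -> `|phi i t - c i j| <= (e / 4)%:C.
  by move=> /(SP j).2; exact: oscE.
have h1 := mean_of_set_pieces fS dS s0 oscS.
have h2 := mean_simple_approx mu_mean PE e4 oscE.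
set z1 := \sum_j _ in h1; set z2 := \sum_j _ in h2.
have h3 : `|z1 - z2| <= (e / 4)%:C.
  rewrite /z1 /z2 -sumrB; apply: (le_trans (ler_norm_sum _ _ _)).
  apply: (@le_trans _ _ (\sum_(j : J) (d * B)%:C)).
    apply: ler_sum => j _; rewrite muE (mulrC (c i j)) -mulrBl -rmorphB /=.
    rewrite normrM rmorphM /= ler_pM//; last exact: cB.
    by rewrite normc_def lecR /= expr0n /= addr0 sqrtr_sqr; exact: Slam.
  have dK : d * ((#|J|%:R + 1) * (B + 1)) = e / 4.
    by rewrite /d divfK// mulf_neq0//; apply: lt0r_neq0; lra.
  rewrite sumr_const -rmorphMn /= lecR -mulr_natr -dK -mulrA ler_pM2l//.
  by move: nJ0 B0; nra.
have -> : mean_of_set m (\big[setU/set0]_j S j) (phi i) - mu (phi i) =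
    (mean_of_set m (\big[setU/set0]_j S j) (phi i) - z1) + (z1 - z2)
    + (z2 - mu (phi i)) by ring.
rewrite distrC in h2.
have -> : e%:C = (e / 4 + e / 4)%:C + (e / 4)%:C + (e / 4)%:C :> R[i].
  by rewrite -!rmorphD /=; congr (_%:C); lra.
rewrite (le_trans (ler_normD _ _))// lerD//.
by rewrite (le_trans (ler_normD _ _))// lerD.
Qed.

Lemma net_filter_filter (I : Type) (le : I -> I -> Prop) :
  directed_preorder le -> Filter (net_filter le).
Proof.
move=> [[i0] _ trans direct]; split.
- by exists i0.
- move=> P Q [i iP] [j jQ]; have [k [ik jk]] := direct i j.
  exists k => l kl.
  by split; [apply/iP/(trans _ _ _ ik)|apply/jQ/(trans _ _ _ jk)].
- by move=> P Q PQ [i iP]; exists i => j ij; exact/PQ/iP.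
Qed.

Lemma weak_star_cvgP (R : realType) (G : topologicalGroupType)
    (m : {measure set (borel G) -> \bar R}) (I : Type) (le : I -> I -> Prop)
    (u : I -> Linfty m -> R[i]^o) (mu : Linfty m -> R[i]^o) :
  directed_preorder le ->
  (forall (phi : Linfty m) (e : R), 0 < e ->
     exists i0, forall i, le i0 i -> `|u i phi - mu phi| < e%:C) ->
  weak_star_cvg le u mu.
Proof.
move=> leP umu; have FF := net_filter_filter leP.
apply/cvg_sup => phi U.
have /= -> :=
  @nbhsE (initial_topology (fun f : Linfty m -> R[i]^o => f phi)) mu.
case=> B [[C oC <- /= Cmu]] /filterS; apply.
have /nbhs_ballP[e /= e0 eC] : nbhs (mu phi) C by exact: open_nbhs_nbhs.
have eE : e = (complex.Re e)%:C by rewrite RRe_real// gtr0_real.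
have [|i0 i0P] := umu phi (complex.Re e); first by rewrite -ltcR -eE.
exists i0 => i /i0P; rewrite -eE => h; apply: eC.
by rewrite -ball_normE /= distrC.
Qed.

Theorem theorem2p6 (R : realType) (G : topologicalGroupType)
    (G_hausdorff : hausdorff_space G)
    (G_locally_compact : locally_compact [set: G])
    (G_not_discrete : ~ (forall A : set G, open A))
    (m : {measure set (borel G) -> \bar R}) (m_haar : left_haar m)
    (mu : {linear Linfty m -> R[i]^o}) (mu_mean : mean mu)
    (x : G) (x_neq1 : x <> 1%g) :
  exists (I : Type) (le : I -> I -> Prop) (S : I -> set G),
    [/\ directed_preorder le,
        forall i, compact_pos m (S i),
        weak_star_cvg le (fun i => mean_of_set m (S i)) mu
      & forall i, S i `&` left_translate x (S i) = set0].
Proof.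
pose I := (seq (Linfty m) * nat)%type.
pose le (a b : I) := {subset a.1 <= b.1} /\ (a.2 <= b.2)%N.
have leP : directed_preorder le.
  split.
  - exact: (inhabits ([::], 0%N)).
  - by move=> a; split.
  - move=> a b c [ab1 ab2] [bc1 bc2]; split; last exact: leq_trans ab2 bc2.
    by move=> phi /ab1/bc1.
  - move=> [a k] [b l]; exists (a ++ b, maxn k l); split; split=> /=.
    + by move=> phi; rewrite mem_cat => ->.
    + exact: leq_maxl.
    + by move=> phi; rewrite mem_cat => ->; rewrite orbT.
    + exact: leq_maxr.
have /choice[S SP] : forall a : I, exists S, [/\ compact_pos m S,
    S `&` left_translate x S = set0
    & forall phi, phi \in a.1 ->
        `|mean_of_set m S phi - mu phi| <= (a.2.+1%:R^-1)%:C].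
  move=> [a k].
  have k0 : 0 < k.+1%:R^-1 :> R by rewrite invr_gt0 ltr0n.
  have [S [Spos Sx Smu]] := mean_of_set_approx (size a) (nth 0 a)
    G_hausdorff m_haar G_not_discrete mu_mean x_neq1 k0.
  exists S; split=> // phi phia; rewrite -(nth_index 0 phia).
  by apply: Smu; rewrite index_mem.
exists I, le, S; split=> //.
- by move=> a; have [] := SP a.
- apply: weak_star_cvgP => // phi e e0.
  pose k := Num.truncn e^-1.
  exists ([:: phi], k) => a [/= sub ka].
  have [_ _ /(_ phi)] := SP a; rewrite sub ?mem_head// => /(_ isT) h.
  apply: (le_lt_trans h); rewrite ltcR.
  rewrite -[ltRHS]invrK ltf_pV2 ?posrE ?invr_gt0// ?ltr0n//.
  by apply: (lt_le_trans (truncnS_gt _)); rewrite ler_nat ltnS.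
- by move=> a; have [] := SP a.
Qed.
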